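(* Let $C\subseteq\mathbb{R}^n$ and $z\in C$. If $C$ is directionally regular at $z$, then $C$ is geometrically derivable at $z$, i.e. $T_C(z)=T_C^i(z)$.
   Context: For $C\subseteq\mathbb{R}^n$ and $z\in C$: $T_C(z)=\{u:\exists t_k\downarrow 0,\ u_k\to u \text{ with } z+t_ku_k\in C\ \forall k\}$; $T^i_C(z)=\{u:\forall t_k\downarrow 0,\ \exists u_k\to u \text{ with } z+t_ku_k\in C\ \forall k\}$ ($t_k\downarrow0$ means $t_k>0$, $t_k\to0$). The regular (Fréchet) normal cone is $\widehat N_C(z)=\{v:\langle v,z'-z\rangle\le o(\|z'-z\|)\ \forall z'\in C\}$ for $z\in C$, and $\widehat N_C(z)=\emptyset$ for $z\notin C$. The directional limiting normal cone is $N_C(z;d)=\{v:\exists t_k\downarrow0,\ d_k\to d,\ v_k\to v\text{ with }v_k\in\widehat N_C(z+t_kd_k)\ \forall k\}$, and the inner directional limiting normal cone is $N^i_C(z;d)=\{v:\forall t_k\downarrow0\ \exists d_k\to d,\ v_k\to v\text{ with }v_k\in\widehat N_C(z+t_kd_k)\ \forall k\}$. $C$ is regular at $z$ in direction $d$ if $N_C(z;d)=N_C^i(z;d)$; $C$ is directionally regular at $z$ if this holds for all $d\in\mathbb{R}^n$. *)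

(* Defs.v *)
From HB Require Import structures.
From mathcomp Require Import all_boot all_order all_algebra.
From mathcomp Require Import all_classical all_reals all_analysis.

Set Implicit Arguments.
Unset Strict Implicit.
Unset Printing Implicit Defensive.

Import Order.TTheory GRing.Theory Num.Theory.
Import numFieldNormedType.Exports.

Local Open Scope classical_set_scope.
Local Open Scope ring_scope.

(* The library topology on 'rV[R]_n (from the sup norm) is the usual one on
   R^n, but its norm `|x| is not Euclidean, hence the explicit [enorm]. *)
Definition dotprod (R : realType) (n : nat) (u v : 'rV[R]_n) : R :=
  \sum_(i < n) u ord0 i * v ord0 i.

Definition enorm (R : realType) (n : nat) (u : 'rV[R]_n) : R :=
  Num.sqrt (dotprod u u).

Definition decr0 (R : realType) (t : nat -> R) : Prop :=
  (forall k, 0 < t k) /\ t @ \oo --> (0 : R).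

Definition tangent_cone (R : realType) (n : nat)
    (C : set 'rV[R]_n) (z : 'rV[R]_n) : set 'rV[R]_n :=
  [set u | exists (t : nat -> R) (w : nat -> 'rV[R]_n),
    [/\ decr0 t, w @ \oo --> u & forall k, C (z + t k *: w k)]].

Definition inner_tangent_cone (R : realType) (n : nat)
    (C : set 'rV[R]_n) (z : 'rV[R]_n) : set 'rV[R]_n :=
  [set u | forall t : nat -> R, decr0 t ->
    exists w : nat -> 'rV[R]_n,
      w @ \oo --> u /\ forall k, C (z + t k *: w k)].

(* The conjunct [C z] makes the cone empty at points outside [C]. *)
Definition regular_normal_cone (R : realType) (n : nat)
    (C : set 'rV[R]_n) (z : 'rV[R]_n) : set 'rV[R]_n :=
  [set v | C z /\ exists r : 'rV[R]_n -> R,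
    (r : 'rV[R]_n -> R^o) =o_z (fun z' => enorm (z' - z) : R^o) /\
    forall z', C z' -> dotprod v (z' - z) <= r z'].

Definition dir_normal_cone (R : realType) (n : nat)
    (C : set 'rV[R]_n) (z d : 'rV[R]_n) : set 'rV[R]_n :=
  [set v | exists (t : nat -> R) (e w : nat -> 'rV[R]_n),
    [/\ decr0 t, e @ \oo --> d, w @ \oo --> v
      & forall k, regular_normal_cone C (z + t k *: e k) (w k)]].

Definition inner_dir_normal_cone (R : realType) (n : nat)
    (C : set 'rV[R]_n) (z d : 'rV[R]_n) : set 'rV[R]_n :=
  [set v | forall t : nat -> R, decr0 t ->
    exists e w : nat -> 'rV[R]_n,
      [/\ e @ \oo --> d, w @ \oo --> v
        & forall k, regular_normal_cone C (z + t k *: e k) (w k)]].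

Definition regular_in_direction (R : realType) (n : nat)
    (C : set 'rV[R]_n) (z d : 'rV[R]_n) : Prop :=
  dir_normal_cone C z d = inner_dir_normal_cone C z d.

Definition directionally_regular (R : realType) (n : nat)
    (C : set 'rV[R]_n) (z : 'rV[R]_n) : Prop :=
  forall d : 'rV[R]_n, regular_in_direction C z d.

Definition geometrically_derivable (R : realType) (n : nat)
    (C : set 'rV[R]_n) (z : 'rV[R]_n) : Prop :=
  tangent_cone C z = inner_tangent_cone C z.

(* Main.v *)
Require Import Defs.
From mathcomp Require Import all_boot all_order all_algebra.
From mathcomp Require Import all_classical all_reals all_analysis.

Set Implicit Arguments.
Unset Strict Implicit.
Unset Printing Implicit Defensive.

Import Order.TTheory GRing.Theory Num.Theory.
Import numFieldNormedType.Exports.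

Local Open Scope classical_set_scope.
Local Open Scope ring_scope.

(** Since [0] is a regular normal exactly at the points of [C], a direction [u]
    is tangent iff [0] is a directional limiting normal in direction [u], and
    inner tangent iff [0] is an inner directional limiting normal: equality of
    the two normal cones in direction [u] transfers [0] from one to the other. *)

Lemma dotprod0v (R : realType) (n : nat) (u : 'rV[R]_n) : dotprod 0 u = 0.
Proof. by rewrite /dotprod big1 // => i _; rewrite mxE mul0r. Qed.

Lemma regular_normal_cone0 (R : realType) (n : nat) (C : set 'rV[R]_n)
    (z : 'rV[R]_n) : C z -> regular_normal_cone C z 0.
Proof.
(* The zero remainder suffices, as the inner product with [0] vanishes. *)
move=> Cz; split=> //; exists (fun=> 0); split; last first.
  by move=> z' _; rewrite dotprod0v.
by apply/eqoP => _/posnumP[e]; near=> x; rewrite normr0 mulr_ge0.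
Unshelve. all: by end_near. Qed.

Lemma tangent_dir_normal0 (R : realType) (n : nat) (C : set 'rV[R]_n)
    (z u : 'rV[R]_n) : tangent_cone C z u -> dir_normal_cone C z u 0.
Proof.
move=> [t [w [t0 wu Cw]]]; exists t, w, (fun=> 0); split=> //.
  exact: cvg_cst.
by move=> k; exact: regular_normal_cone0.
Qed.

(** Any [v] serves, not just [0]: regular normals exist only at points of [C], so the directions [e]
    tending to [u] are already the required witnesses. *)
Lemma inner_dir_normal_inner_tangent (R : realType) (n : nat)
    (C : set 'rV[R]_n) (z u v : 'rV[R]_n) :
  inner_dir_normal_cone C z u v -> inner_tangent_cone C z u.
Proof.
move=> Nv t /Nv [e [w [eu _ Ne]]]; exists e; split=> // k.
by have [] := Ne k.
Qed.

Lemma inner_tangent_cone_sub (R : realType) (n : nat) (C : set 'rV[R]_n)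
    (z : 'rV[R]_n) : inner_tangent_cone C z `<=` tangent_cone C z.
Proof.
(* Passing from all step sequences to some needs one to exist: [harmonic], with terms 1/(k+1), is
   positive from [k = 0] on. *)
move=> u Tu; have h0 : decr0 (@harmonic R).
  by split; [move=> k; exact: harmonic_gt0 | exact: cvg_harmonic].
by have [w [wu Cw]] := Tu _ h0; exists harmonic, w.
Qed.

Theorem corollary3p1 (R : realType) (n : nat)
    (C : set 'rV[R]_n) (z : 'rV[R]_n) (hz : C z)
    (hreg : directionally_regular C z) :
  geometrically_derivable C z.
Proof.
apply/seteqP; split; last exact: inner_tangent_cone_sub.
move=> u /tangent_dir_normal0; rewrite hreg.
exact: inner_dir_normal_inner_tangent.
Qed.
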